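(* Let $n\ge2$ and let $T$ be a $2n$-dimensional Euclidean space with orthogonal complex structure $J$. Let $C:\mathbf U(T)\to\overline{\mathbf T}(T)$ be the linear isomorphism $\alpha\mapsto h$, $h_{XYZ}=-\frac12\alpha(X,Y,JZ)$ (which sends $(\nabla\Phi)_p$ to the second fundamental tensor $h_p$ of an almost Hermitian structure). Then $C(\mathbf U_i)=\overline{\mathbf T}_i$ for $i=1,2,3,4$.
   Context: $T$ has inner product $\langle\,,\rangle$; $J^2=-I$, $\langle JX,JY\rangle=\langle X,Y\rangle$. $E_1,\dots,E_n,JE_1,\dots,JE_n$ is an orthonormal basis; $\mathfrak S$ is the cyclic sum over $X,Y,Z$; all conditions are for all $X,Y,Z\in T$. $\mathbf U(T)=\{\alpha\in\otimes^3T^*:\alpha(X,Y,Z)=-\alpha(X,Z,Y)=-\alpha(X,JY,JZ)\}$ ($\alpha$ plays the role of $\nabla\Phi$, $\Phi(X,Y)=\langle JX,Y\rangle$). With $\delta\Phi(X)=-\sum_{i=1}^n[\alpha(E_i,E_i,X)+\alpha(JE_i,JE_i,X)]$ the Gray–Hervella subspaces of $\mathbf U(T)$ are: $\mathbf U_1$: $\alpha(X,X,Y)=0$; $\mathbf U_2$: $\mathfrak S\,\alpha(X,Y,Z)=0$ (i.e. $d\Phi=0$); $\mathbf U_3$: $\alpha(X,Y,Z)-\alpha(JX,JY,Z)=\delta\Phi(Z)=0$; $\mathbf U_4$: $\alpha(X,Y,Z)=\frac{-1}{2(n-1)}\{\langle X,Y\rangle\delta\Phi(Z)-\langle X,Z\rangle\delta\Phi(Y)-\langle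 X,JY\rangle\delta\Phi(JZ)+\langle X,JZ\rangle\delta\Phi(JY)\}$. $\overline{\mathbf T}(T)=\{h\in\otimes^3T^*:h_{XYZ}=-h_{XZY}=-h_{X\,JY\,JZ}\}$. With $\beta(X)=\sum_{i=1}^n[h_{E_iE_iX}+h_{JE_iJE_iX}]$, define the subspaces of $\overline{\mathbf T}(T)$: $\overline{\mathbf T}_1$: $h_{XXZ}=0$; $\overline{\mathbf T}_2$: $\mathfrak S\,h_{XYZ}=0$; $\overline{\mathbf T}_3$: $h_{XYZ}-h_{JX\,JY\,Z}=\beta(Z)=0$; $\overline{\mathbf T}_4$: $h_{XYZ}=\frac1{2(n-1)}[\langle X,Y\rangle\beta(Z)-\langle X,Z\rangle\beta(Y)-\langle X,JY\rangle\beta(JZ)+\langle X,JZ\rangle\beta(JY)]$. *)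

(* Defs.v *)
From HB Require Import structures.
From mathcomp Require Import all_boot all_order all_algebra sesquilinear.
From mathcomp Require Import classical_sets functions reals.

Set Implicit Arguments.
Unset Strict Implicit.
Unset Printing Implicit Defensive.

Import Order.TTheory GRing.Theory Num.Theory.
Local Open Scope ring_scope.
Local Open Scope classical_set_scope.

(* Covariant 3-tensors, i.e. trilinear forms in curried form. *)
Notation tensor3 R T := 'Hom(T, 'Hom(T, 'Hom(T, R^o))).

Section Tensors.
Variables (R : realType) (T : vectType R).

(* Typing the value in [R] rather than [R^o] keeps the canonical structures of
   [R] in formulas. *)
Definition ev (t : tensor3 R T) (X Y Z : T) : R := t X Y Z.

(* [linfun] is total: this has the values of [f] only for a trilinear [f],
   see [tensor_ofE]. *)
Definition tensor_of (f : T -> T -> T -> R) : 'Hom(T, 'Hom(T, 'Hom(T, R^o))) :=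
  linfun (fun X => linfun (fun Y => linfun (f X Y : T -> R^o))).

Lemma linfunE_linear (V : vectType R) (f : T -> V) : linear f -> linfun f =1 f.
Proof.
move=> lf u.
pose fL := GRing.isLinear.Build R T V *:%R f lf.
pose F : {linear T -> V} := HB.pack_for {linear T -> V} f fL.
exact: (lfunE F u).
Qed.

Lemma tensor_ofE (f : T -> T -> T -> R) :
  (forall Y Z, linear (fun X => f X Y Z : R^o)) ->
  (forall X Z, linear (fun Y => f X Y Z : R^o)) ->
  (forall X Y, linear (f X Y : T -> R^o)) ->
  forall X Y Z, ev (tensor_of f) X Y Z = f X Y Z.
Proof.
move=> l1 l2 l3.
have E3 X Y Z : linfun (f X Y : T -> R^o) Z = f X Y Z.
  by rewrite linfunE_linear.
have E2 X Y Z : linfun (fun Y => linfun (f X Y : T -> R^o)) Y Z = f X Y Z.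
  rewrite linfunE_linear ?E3// => a u v; apply/lfunP => z.
  by rewrite add_lfunE scale_lfunE !E3; apply: l2.
move=> X Y Z; rewrite /ev linfunE_linear ?E2// => a u v.
apply/lfunP => y; apply/lfunP => z.
by rewrite !(add_lfunE, scale_lfunE) !E2; apply: l1.
Qed.

Variables (g : {dot T for idfun}) (J : 'End(T)).

Definition is_orthogonal_complex_structure : Prop :=
  (forall X, J (J X) = - X) /\ (forall X Y, g (J X) (J Y) = g X Y).

(* E_1, ..., E_n, JE_1, ..., JE_n is an orthonormal basis of T. *)
Definition is_unitary_frame (n : nat) (E : n.-tuple T) : Prop :=
  basis_of fullv (E ++ map J E) /\ orthonormal g (E ++ map J E).

Definition UT : set (tensor3 R T) := [set alpha | forall X Y Z,
  ev alpha X Y Z = - ev alpha X Z Y /\ ev alpha X Y Z = - ev alpha X (J Y) (J Z)].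

Definition TbarT : set (tensor3 R T) := [set h | forall X Y Z,
  ev h X Y Z = - ev h X Z Y /\ ev h X Y Z = - ev h X (J Y) (J Z)].

Definition cyclic_sum (t : tensor3 R T) (X Y Z : T) : R :=
  ev t X Y Z + ev t Y Z X + ev t Z X Y.

Definition secondfund (alpha : tensor3 R T) : tensor3 R T :=
  tensor_of (fun X Y Z => - (1 / 2) * ev alpha X Y (J Z)).

Lemma secondfundE (alpha : tensor3 R T) X Y Z :
  ev (secondfund alpha) X Y Z = - (1 / 2) * ev alpha X Y (J Z).
Proof.
apply: tensor_ofE => {X Y Z} [Y Z|X Z|X Y] a u v; rewrite /ev;
  by rewrite ?linearP ?(add_lfunE, scale_lfunE, linearP) mulrDr /=
             /GRing.scale /= mulrCA.
Qed.

Variables (n : nat) (E : n.-tuple T).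

Definition deltaPhi (alpha : tensor3 R T) (X : T) : R :=
  - \sum_(i < n) (ev alpha (tnth E i) (tnth E i) X +
                  ev alpha (J (tnth E i)) (J (tnth E i)) X).

Definition beta (h : tensor3 R T) (X : T) : R :=
  \sum_(i < n) (ev h (tnth E i) (tnth E i) X +
                ev h (J (tnth E i)) (J (tnth E i)) X).

Definition U1 : set (tensor3 R T) :=
  [set alpha | UT alpha /\ forall X Y, ev alpha X X Y = 0].

Definition U2 : set (tensor3 R T) :=
  [set alpha | UT alpha /\ forall X Y Z, cyclic_sum alpha X Y Z = 0].

Definition U3 : set (tensor3 R T) := [set alpha | UT alpha /\
  forall X Y Z, ev alpha X Y Z - ev alpha (J X) (J Y) Z = 0 /\ deltaPhi alpha Z = 0].

Definition U4 : set (tensor3 R T) := [set alpha | UT alpha /\ forall X Y Z,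
  ev alpha X Y Z = - 1 / (2 * (n%:R - 1)) *
    (g X Y * deltaPhi alpha Z - g X Z * deltaPhi alpha Y
     - g X (J Y) * deltaPhi alpha (J Z) + g X (J Z) * deltaPhi alpha (J Y))].

Definition Tbar1 : set (tensor3 R T) :=
  [set h | TbarT h /\ forall X Z, ev h X X Z = 0].

Definition Tbar2 : set (tensor3 R T) :=
  [set h | TbarT h /\ forall X Y Z, cyclic_sum h X Y Z = 0].

Definition Tbar3 : set (tensor3 R T) := [set h | TbarT h /\
  forall X Y Z, ev h X Y Z - ev h (J X) (J Y) Z = 0 /\ beta h Z = 0].

Definition Tbar4 : set (tensor3 R T) := [set h | TbarT h /\ forall X Y Z,
  ev h X Y Z = 1 / (2 * (n%:R - 1)) *
    (g X Y * beta h Z - g X Z * beta h Y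
     - g X (J Y) * beta h (J Z) + g X (J Z) * beta h (J Y))].

End Tensors.

(* Main.v *)
Require Import Defs.
From mathcomp Require Import all_boot all_order all_algebra sesquilinear.
From mathcomp Require Import classical_sets functions reals.
From mathcomp Require Import ring lra.
Set Implicit Arguments.
Unset Strict Implicit.
Import GRing.Theory Num.Theory.
Local Open Scope ring_scope.
Local Open Scope classical_set_scope.

(** The two families of conditions are literally the same: [UT] and [TbarT]
    have the same defining equations, and since [deltaPhi] is the opposite of
    [beta], each [U_i] equals the [Tbar_i] of the same index as a set of
    tensors.  What has to be shown is therefore that [secondfund] restricts to
    a bijection of each of these sets onto itself.

    Up to a scalar, [secondfund] is the twist of the last argument by [J].
    Because [J] squares to minus the identity, twisting twice is again a scalar,
    so the inverse of [secondfund] is also a multiple of the twist, and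
    it is enough that every multiple of the twist preserves the set in question
    ([secondfund_image]).  For the classes 1, 3 and 4 this is a substitution
    of [J Z] for [Z], once one knows that the trace [deltaPhi] is twisted in the
    same way.  The class 2 is the only one where the cyclic sum mixes the
    arguments: there one first derives the quasi-Kaehler identity
    [alpha(JX, JY, Z) = - alpha(X, Y, Z)], which lets [J] move between all three
    arguments ([U2_quasi_kaehler]). *)

Section Twist.
Variables (R : realType) (T : vectType R) (J : 'End(T)).
Hypothesis JJ : forall X, J (J X) = - X.
Implicit Types (a b : tensor3 R T) (X Y Z : T).

Lemma evNl a X Y Z : ev a (- X) Y Z = - ev a X Y Z.
Proof. by rewrite /ev linearN !opp_lfunE. Qed.

Lemma evNm a X Y Z : ev a X (- Y) Z = - ev a X Y Z.
Proof. by rewrite /ev linearN opp_lfunE. Qed.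

Lemma evNr a X Y Z : ev a X Y (- Z) = - ev a X Y Z.
Proof. by rewrite /ev linearN. Qed.

Lemma ev_ext a b : (forall X Y Z, ev a X Y Z = ev b X Y Z) -> a = b.
Proof.
by move=> ab; apply/lfunP => X; apply/lfunP => Y; apply/lfunP => Z; apply: ab.
Qed.

Lemma ev_scale k a X Y Z : ev (k *: a) X Y Z = k * ev a X Y Z.
Proof. by rewrite /ev !scale_lfunE. Qed.

Lemma ev_add a b X Y Z : ev (a + b) X Y Z = ev a X Y Z + ev b X Y Z.
Proof. by rewrite /ev !add_lfunE. Qed.

(** The relation is used, rather than an operator, so that [secondfund] and its
    inverse are both instances of it, for different values of [k]. *)
Definition twist (k : R) a b := forall X Y Z, ev b X Y Z = k * ev a X Y (J Z).

Definition twist_stable (S : set (tensor3 R T)) :=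
  forall k a b, twist k a b -> S a -> S b.

Lemma secondfund_twist a : twist (- (1 / 2)) a (secondfund J a).
Proof. by move=> X Y Z; rewrite secondfundE. Qed.

Lemma secondfund_linear : linear (secondfund J : tensor3 R T -> tensor3 R T).
Proof.
move=> k a b; apply: ev_ext => X Y Z.
rewrite secondfundE !(ev_add, ev_scale, secondfundE); ring.
Qed.

(** The scalar is [(1/2)^2 * (-1)], the sign being that of the square of [J]. *)
Lemma secondfundK a : secondfund J (secondfund J a) = - (1 / 4) *: a.
Proof.
apply: ev_ext => X Y Z; rewrite ev_scale !secondfundE JJ evNr; lra.
Qed.

Lemma secondfund_inj : injective (secondfund J : tensor3 R T -> tensor3 R T).
Proof.
move=> a b /(congr1 (secondfund J)); rewrite !secondfundK.
by apply: scalerI; apply/eqP; lra.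
Qed.

Lemma secondfund_image S : twist_stable S -> secondfund J @` S = S.
Proof.
move=> stS; apply/seteqP; split=> [_ [a Sa <-]|h Sh] /=.
  exact: stS (secondfund_twist a) Sa.
exists (- 4 *: secondfund J h).
  (* The candidate inverse is the twist by [2 = (-4) * (-1/2)]. *)
  apply: (stS 2 h) => // X Y Z; rewrite ev_scale secondfundE; lra.
apply: ev_ext => X Y Z; rewrite secondfundE ev_scale secondfundE JJ evNr; lra.
Qed.

Section Symmetries.
Variable a : tensor3 R T.
Hypothesis Ua : UT J a.

Lemma UT_swap X Y Z : ev a X Z Y = - ev a X Y Z.
Proof. by have [] := Ua X Z Y. Qed.

Lemma UT_shift X Y Z : ev a X (J Y) Z = ev a X Y (J Z).
Proof. by have [_ ->] := Ua X (J Y) Z; rewrite JJ evNm opprK. Qed.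

End Symmetries.

Lemma UT_twist : twist_stable (UT J).
Proof.
move=> k a b ab Ua X Y Z; rewrite !ab; split.
  rewrite (UT_swap Ua X (J Y)) (UT_shift Ua); ring.
rewrite (UT_shift Ua) JJ !evNr; ring.
Qed.

Lemma U1_twist : twist_stable (U1 J).
Proof.
move=> k a b ab [Ua a0]; split; first exact: UT_twist ab Ua.
by move=> X Y; rewrite ab a0 mulr0.
Qed.

(** With [S] the cyclic sum, form [S(X, Y, Z) - S(X, JY, JZ)]: its first term
    is [2 alpha(X, Y, Z)].  Replacing [X, Y] by [JX, JY] changes the sign of the
    remaining terms, so they cancel when the two expressions are added. *)
Lemma U2_quasi_kaehler a : U2 J a ->
  forall X Y Z, ev a (J X) (J Y) Z = - ev a X Y Z.
Proof.
move=> [Ua a0] X Y Z.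
have := a0 X Y Z; have := a0 X (J Y) (J Z).
have := a0 (J X) (J Y) Z; have := a0 (J X) (J (J Y)) (J Z).
rewrite /cyclic_sum !JJ ?(evNl, evNm, evNr) !(UT_shift Ua) !JJ.
rewrite ?(evNl, evNm, evNr).
lra.
Qed.

(** The condition at [(X, Y, JZ)] already is the cyclic sum of the twist: in
    each term [J] can be moved to the last argument, across the first one by
    the quasi-Kaehler identity. *)
Lemma U2_twist : twist_stable (U2 J).
Proof.
move=> k a b ab Ua2; have [Ua a0] := Ua2.
split=> [|X Y Z]; first exact: UT_twist ab Ua.
have outer X1 Y1 Z1 : ev a (J X1) Y1 Z1 = ev a X1 Y1 (J Z1).
  rewrite -(UT_shift Ua) -[LHS]opprK -(U2_quasi_kaehler Ua2) JJ evNl opprK //.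
have := a0 X Y (J Z).
by rewrite /cyclic_sum !ab -!mulrDr outer (UT_shift Ua) => ->; rewrite mulr0.
Qed.

Section Traces.
Variables (n : nat) (E : n.-tuple T).

Lemma beta_deltaPhi a X : beta J E a X = - deltaPhi J E a X.
Proof. by rewrite /deltaPhi opprK. Qed.

Lemma deltaPhi_twist k a b : twist k a b ->
  forall Z, deltaPhi J E b Z = k * deltaPhi J E a (J Z).
Proof.
move=> ab Z; rewrite /deltaPhi mulrN mulr_sumr; congr (- _).
by apply: eq_bigr => i _; rewrite !ab mulrDr.
Qed.

Lemma deltaPhiN a X : deltaPhi J E a (- X) = - deltaPhi J E a X.
Proof.
rewrite /deltaPhi; congr (- _); rewrite -sumrN.
by apply: eq_bigr => i _; rewrite !evNr opprD.
Qed.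

Lemma U3_twist : twist_stable (U3 J E).
Proof.
move=> k a b ab [Ua a0]; split; first exact: UT_twist ab Ua.
move=> X Y Z; have [aJ dJ] := a0 X Y (J Z).
by rewrite (deltaPhi_twist ab) dJ !ab -mulrBr aJ !mulr0.
Qed.

(** Substituting [J Z] for [Z] on the right-hand side exchanges the terms with
    [g X Z] and [g X (J Z)]; the other two keep their metric factor, and their
    traces become those of the twist. *)
Lemma U4_twist (g : {dot T for idfun}) : twist_stable (U4 g J E).
Proof.
move=> k a b ab [Ua a0]; split; first exact: UT_twist ab Ua.
move=> X Y Z.
have gN U V : g U (- V) = - g U V by rewrite linearN.
rewrite ab a0 !(deltaPhi_twist ab) !JJ !deltaPhiN gN; ring.
Qed.

Lemma Tbar3_U3 : Tbar3 J E = U3 J E.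
Proof.
apply/seteqP; split=> a [Ua a0]; split=> // X Y Z; have [aJ] := a0 X Y Z.
  by rewrite beta_deltaPhi => /eqP; rewrite oppr_eq0 => /eqP.
by rewrite beta_deltaPhi => ->; rewrite oppr0.
Qed.

Lemma Tbar4_U4 (g : {dot T for idfun}) : Tbar4 g J E = U4 g J E.
Proof.
apply/seteqP; split=> a [Ua a0]; split=> // X Y Z;
  rewrite a0 !beta_deltaPhi; ring.
Qed.

End Traces.
End Twist.

Theorem theorem5p20 (R : realType) (T : vectType R) (n : nat)
    (g : {dot T for idfun}) (J : 'End(T)) (E : n.-tuple T)
    (hn : (2 <= n)%N) (hdim : \dim {:T} = (2 * n)%N)
    (hJ : is_orthogonal_complex_structure g J)
    (hE : is_unitary_frame g J E) :
  (linear (secondfund J : tensor3 R T -> tensor3 R T) /\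
   set_bij (UT J) (TbarT J) (secondfund J)) /\
  [/\ secondfund J @` U1 J = Tbar1 J,
      secondfund J @` U2 J = Tbar2 J,
      secondfund J @` U3 J E = Tbar3 J E
    & secondfund J @` U4 g J E = Tbar4 g J E].
Proof.
have [JJ _] := hJ.
split; first split; first exact: secondfund_linear.
  have imU : secondfund J @` UT J = TbarT J.
    by apply: secondfund_image => //; exact: UT_twist.
  split=> [a Ua|a b _ _|h].
  - by rewrite -imU; exists a.
  - exact: secondfund_inj.
  - by rewrite -imU.
rewrite Tbar3_U3 Tbar4_U4; split; apply: secondfund_image => //.
- exact: U1_twist.
- exact: U2_twist.
- exact: U3_twist.
- exact: U4_twist.
Qed.
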